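(* For $n\ge1$ let $N_m(n)$ be the total number of pairs $(A,M)$ where $A$ is a labeled tree on $\{1,\dots,n\}$ and $M$ is a maximum-cardinality matching of $A$. Let $F_m(x)=\sum_{n\ge1}\frac{N_m(n)}{n!}x^n$. Then, as formal power series, $$F_m(x)=-\tfrac12\big(xe^U+U\big)^2+\big(1+Uxe^U\big)xe^U+U-U^2,$$ where $U=U(x)$ is the formal power series with $U(0)=0$ satisfying $U=x^2\exp\!\big(-x^2e^{2U}+xe^U+3U\big)$. The first values ($n=1,\dots,10$) are $N_m=(1,1,6,24,320,3270,55482,999656,21718440,544829130)$.
   Context: A matching of a graph is a set of pairwise non-adjacent edges; maximum-cardinality means of largest possible size (the empty matching is the maximum matching of the one-vertex tree). *)

(* Defs.v *)
From HB Require Import structures.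
From mathcomp Require Import all_boot all_order all_algebra.
Set Implicit Arguments. Unset Strict Implicit. Unset Printing Implicit Defensive.
Import Order.TTheory GRing.Theory Num.Theory.

Definition adj n (E : {set {set 'I_n}}) : rel 'I_n :=
  fun u v => [set u; v] \in E.

Definition is_simple_graph n (E : {set {set 'I_n}}) : bool :=
  [forall e in E, #|e| == 2].

Definition connectedb n (E : {set {set 'I_n}}) : bool :=
  [forall u, forall v, connect (adj E) u v].

Definition is_tree n (E : {set {set 'I_n}}) : bool :=
  [&& is_simple_graph E, connectedb E & #|E| == n.-1].

Definition is_matching n (E M : {set {set 'I_n}}) : bool :=
  (M \subset E) && trivIset M.

Definition is_max_matching n (E M : {set {set 'I_n}}) : bool :=
  is_matching E M &&
  [forall M' : {set {set 'I_n}}, is_matching E M' ==> (#|M'| <= #|M|)].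

Definition Nm (n : nat) : nat :=
  #|[set p : {set {set 'I_n}} * {set {set 'I_n}} |
      is_tree p.1 && is_max_matching p.1 p.2]|.

Local Open Scope ring_scope.

Definition fps := nat -> rat.

Definition fps_const (c : rat) : fps := fun n => if n is 0%N then c else 0.
Definition fps_X : fps := fun n => if n == 1%N then 1 else 0.
Definition fps_add (f g : fps) : fps := fun n => f n + g n.
Definition fps_opp (f : fps) : fps := fun n => - f n.
Definition fps_scale (c : rat) (f : fps) : fps := fun n => c * f n.
Definition fps_mul (f g : fps) : fps :=
  fun n => \sum_(i < n.+1) f i * g (n - i)%N.
Definition fps_pow (f : fps) (k : nat) : fps := iter k (fps_mul f) (fps_const 1).
(* exp of a series with zero constant term: exp f = sum_k f^k / k!; for
   f 0 = 0 the coefficient of x^n only involves k <= n. *)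
Definition fps_exp (f : fps) : fps :=
  fun n => \sum_(k < n.+1) fps_pow f k n / (k`!)%:R.

Definition Fm : fps := fun n => if n is 0%N then 0 else (Nm n)%:R / (n`!)%:R.

Definition U_equation (U : fps) : Prop :=
  forall n, U n =
    fps_mul (fps_pow fps_X 2)
      (fps_exp (fps_add (fps_add
          (fps_opp (fps_mul (fps_pow fps_X 2) (fps_exp (fps_scale 2 U))))
          (fps_mul fps_X (fps_exp U)))
          (fps_scale 3 U))) n.

Definition Fm_formula (U : fps) : fps :=
  let xeU := fps_mul fps_X (fps_exp U) in
  fps_add (fps_add (fps_add
    (fps_scale (- (1 / 2)) (fps_pow (fps_add xeU U) 2))
    (fps_mul (fps_add (fps_const 1) (fps_mul U xeU)) xeU))
    U)
    (fps_opp (fps_pow U 2)).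

(* Main.v *)
(** Root the tree at [r] and let [f], [g] be the matching polynomials of the tree
    and of the tree minus [r].  The degrees of [f] and [g] agree exactly when some
    maximum matching misses [r] (the root is free), and the leading coefficients
    count maximum matchings.  Joining a tree rooted at [c] to one rooted at [r] by
    the edge [rc] acts on the pairs [(f, g)] by an explicit rule, so on the four
    statistics (free or not, leading coefficient of [f] or [g]) it is bilinear.
    A rooted tree with a marked vertex [w] distinct from the root splits uniquely
    along the first edge of the path from the root to [w]; as there are [n - 1]
    choices of [w], the four exponential generating functions satisfy, with
    [theta = x d/dx], a system [theta X_i - X_i = sum_jl K_ijl X_j theta X_l].
    Write [A], [A0] for the statistics of [f], [g] over free roots and [B], [P]
    over the others.  Uniqueness of solutions of linear equations in [theta] gives
    [A0 = x e^B], [A0 + P = x e^(A+B)], [B = A0 (A0 + P)] and [A = A0 (1 + P)], so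
    [U = B] solves the equation of the theorem.  Since [n N_m(n) / n!] is the
    coefficient of [A + B], it remains to see that [theta] maps the right-hand side
    of the formula to [A + B], and this follows by adding two of the equations. *)
From HB Require Import structures.
From Stdlib Require Import NArith DecimalNat DecimalPos.
Require Import Defs.
From mathcomp Require Import all_boot all_order all_algebra.
From mathcomp Require Import boolp zify ring.
Set Implicit Arguments. Unset Strict Implicit. Unset Printing Implicit Defensive.
Import Order.TTheory GRing.Theory Num.Theory.

(** * Splitting a tree along an edge at the root *)

Lemma connect_ind (T : finType) (e : rel T) (P : T -> Prop) x y :
  (forall a b, P a -> e a b -> P b) -> P x -> connect e x y -> P y.
Proof.
move=> stepP Px /connectP[p]; elim: p x Px => [|z p IHp] x Px /=.
  by move=> _ ->.
by case/andP=> exz; apply: IHp; apply: stepP exz.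
Qed.

Section Trees.
Variable V : finType.
Implicit Types (E F M : {set {set V}}) (S C : {set V}) (r c u v w : V).

Definition edge_rel E : rel V := fun u v => [set u; v] \in E.

Definition graph_on S E := [forall e in E, (e \subset S) && (#|e| == 2)].

Definition connected_on S E := [forall u in S, forall v in S, connect (edge_rel E) u v].

Definition tree_on S E := [&& graph_on S E, connected_on S E & #|E| == #|S|.-1].

Definition del_vertex E r := [set e in E | r \notin e].

Definition induced E C := [set e in E | e \subset C].

Lemma graph_onP S E e : graph_on S E -> e \in E -> e \subset S /\ #|e| = 2.
Proof. by move=> /forall_inP/[apply]/andP[? /eqP]. Qed.

Lemma connected_onP S E u v :
  connected_on S E -> u \in S -> v \in S -> connect (edge_rel E) u v.
Proof. by move/forall_inP=> H uS vS; move/forall_inP: (H u uS); apply. Qed.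

Lemma edge_rel_connect_sym E : connect_sym (edge_rel E).
Proof. by apply: sym_connect_sym => u v; rewrite /edge_rel setUC. Qed.

Lemma connected_on_root S E r :
  (forall v, v \in S -> connect (edge_rel E) r v) -> connected_on S E.
Proof.
move=> H; apply/forall_inP=> u uS; apply/forall_inP=> v vS.
by apply: connect_trans (H v vS); rewrite edge_rel_connect_sym H.
Qed.

Lemma connect_edge_relS E F u v :
  E \subset F -> connect (edge_rel E) u v -> connect (edge_rel F) u v.
Proof.
by move=> sEF; apply: connect_sub => x y xy; apply/connect1/(subsetP sEF).
Qed.

Lemma graph_on_induced S E C : graph_on S E -> graph_on C (induced E C).
Proof.
move=> gE; apply/forall_inP=> e; rewrite inE => /andP[eE ->] /=.
by have [_ ->] := graph_onP gE eE.
Qed.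

(* The component of [w] once [r] is deleted. *)
Definition branch E r w := [set v | connect (edge_rel (del_vertex E r)) w v].

Lemma branch_step E r w x y :
  x \in branch E r w -> [set x; y] \in E -> r != x -> r != y -> y \in branch E r w.
Proof.
rewrite !inE => wx xyE rx ry; apply: connect_trans wx (connect1 _).
by rewrite /edge_rel !inE xyE negb_or rx ry.
Qed.

(** * Cutting off the branch that contains a vertex *)

Section Branch.
Variables (S : {set V}) (E : {set {set V}}) (r w : V).
Hypotheses (gE : graph_on S E) (cE : connected_on S E).
Hypotheses (rS : r \in S) (wS : w \in S) (wr : w != r).
Let C := branch E r w.

Lemma branch_root : w \in C. Proof. by rewrite inE connect0. Qed.

Lemma branchN : r \notin C.
Proof.
have: forall v, connect (edge_rel (del_vertex E r)) w v -> v != r.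
  move=> v; apply: (connect_ind (P := fun v => v != r)) => // a b _.
  rewrite /edge_rel !inE negb_or.
  by case/and3P=> _ _; rewrite eq_sym.
by move=> H; rewrite inE; apply/negP => /H; rewrite eqxx.
Qed.

Lemma branch_sub : C \subset S.
Proof.
apply/subsetP=> v; rewrite inE; apply: (connect_ind (P := fun v => v \in S)) => // a b _.
rewrite /edge_rel inE => /andP[abE _].
by have [/subsetP->] := graph_onP gE abE; rewrite // !inE eqxx orbT.
Qed.

Lemma branch_neq x : x \in C -> r != x.
Proof. by apply: contraTneq => <-; exact: branchN. Qed.

Lemma branch_connected : connected_on C (induced E C).
Proof.
apply: (@connected_on_root _ _ w) => v; rewrite {1}inE => wv.
(* Membership in [C] is carried along with reachability: it is what puts each new edge into the
   induced graph. *)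
pose P u := u \in C /\ connect (edge_rel (induced E C)) w u.
suff [_ //]: P v.
apply: (connect_ind (P := P)) wv; last by split; [exact: branch_root | exact: connect0].
move=> a b [aC wa]; rewrite /edge_rel !inE => /andP[abE].
rewrite negb_or => /andP[ra rb].
have bC: b \in C by apply: branch_step ra rb.
split=> //; apply: connect_trans wa (connect1 _).
by rewrite /edge_rel inE abE subUset !sub1set aC bC.
Qed.

(** The branch is closed under edges that avoid [r], so a path starting at [r] that enters the
    branch can leave it only through [r] itself. The part of the path after the last such return
    stays in the trunk. *)
Lemma trunk_connected : connected_on (S :\: C) (induced E (S :\: C)).
Proof.
apply: (@connected_on_root _ _ r) => v; rewrite inE => /andP[vC vS].
pose P u := u \in C \/ connect (edge_rel (induced E (S :\: C))) r u.
suff: P v by case=> // vC'; rewrite vC' in vC.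
apply: (connect_ind (P := P)) (connected_onP cE rS vS); last by right; exact: connect0.
move=> a b IH; rewrite {1}/edge_rel => abE; case: (boolP (b \in C)) => bC; first by left.
right; case: (boolP (a \in C)) => aC.
  case: (eqVneq r b) => [<-|rb]; first exact: connect0.
  by rewrite (branch_step aC abE (branch_neq aC) rb) in bC.
case: IH => [aC'|ra]; first by case/negP: aC.
apply: connect_trans ra (connect1 _); rewrite /edge_rel inE abE.
have [/subsetP abS _] := graph_onP gE abE.
by rewrite subUset !sub1set !in_setD aC bC !abS // !inE eqxx ?orbT.
Qed.

(** A path from [w] to [r] stays in the branch until it first meets [r], and the edge by which it
    does so is the required one. *)
Lemma branch_attach : exists2 c, c \in C & [set r; c] \in E.
Proof.
pose P u := u \in C \/ exists2 c, c \in C & [set r; c] \in E.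
suff: P r.
  by case=> // rC; have := branchN; rewrite rC.
apply: (connect_ind (P := P)) (connected_onP cE wS rS); last by left; exact: branch_root.
move=> a b [aC abE|? _]; last by right.
move: abE; rewrite /edge_rel; case: (eqVneq r b) => [<-|rb] abE; last first.
  by left; exact: branch_step abE (branch_neq aC) rb.
by right; exists a; rewrite // setUC.
Qed.

(** For a graph on [S] these are the edges with one end in the branch and the other in the trunk. In
    a tree there is exactly one. *)
Definition attach_edges := E :\: (induced E C :|: induced E (S :\: C)).

Lemma card_branch_edges :
  #|E| = #|induced E C| + #|induced E (S :\: C)| + #|attach_edges|.
Proof.
rewrite -cardsUI [_ :&: induced _ _](_ : _ = set0) ?cards0 ?addn0.
  rewrite -(cardsID (induced E C :|: induced E (S :\: C)) E).
  congr (#|pred_of_set _| + _); apply/setIidPr.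
  by apply/subsetP => e; rewrite !inE => /orP[]/andP[].
apply/setP=> e; rewrite !inE; apply/negP => /andP[/andP[eE eC] /andP[_]].
rewrite subsetD => /andP[_ /setDidPl]; rewrite (_ : _ :\: _ = set0).
  by move=> e0; have [_] := graph_onP gE eE; rewrite -e0 cards0.
by apply/eqP; rewrite setD_eq0.
Qed.

Lemma mem_attach c : c \in C -> [set r; c] \in E -> [set r; c] \in attach_edges.
Proof.
move=> cC rcE.
rewrite in_setD in_setU !(in_set (fun e => _ && _)) rcE /= !subUset !sub1set !in_setD cC.
by rewrite (negPf branchN) andbF.
Qed.

End Branch.

(** Strong induction on [#|S|]: the branch and the trunk are smaller connected graphs, and at least
    one further edge joins them, so the two lower bounds on the edges add up. *)
Lemma connected_card S E : graph_on S E -> connected_on S E -> #|S| <= #|E|.+1.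
Proof.
elim: {S}_.+1 {-2}S (ltnSn #|S|) E => // n IHn S leSn E gE cE.
case: (set_0Vmem S) => [->|[r rS]]; first by rewrite cards0.
case: (set_0Vmem (S :\ r)) => [S1|[w]].
  by rewrite (cardsD1 r) S1 cards0 rS.
rewrite !inE => /andP[wr wS].
have sCS := branch_sub r gE wS; set C := branch E r w in sCS *.
have rC : r \notin C := branchN _ wr.
have [c cC rcE] := branch_attach cE rS wS wr.
have cS : #|S| = #|C| + #|S :\: C| by rewrite -(cardsID C S) (setIidPr sCS).
have C0 : 0 < #|C| by apply/card_gt0P; exists w; exact: branch_root.
have D0 : 0 < #|S :\: C| by apply/card_gt0P; exists r; rewrite inE rC.
have [ltCn ltDn] : #|C| < n /\ #|S :\: C| < n.
  by move: leSn C0 D0; rewrite cS; move: #|C| #|_ :\: _|; clear; lia.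
have I1 : #|C| <= #|induced E C|.+1.
  by apply: IHn; [by []|exact: graph_on_induced gE|exact: branch_connected].
have I2 : #|S :\: C| <= #|induced E (S :\: C)|.+1.
  by apply: IHn; [by []|exact: graph_on_induced gE|exact: trunk_connected].
have a0 : 0 < #|attach_edges S E r w|.
  by apply/card_gt0P; exists [set r; c]; apply: mem_attach.
rewrite (card_branch_edges r w gE) -/C cS; move: I1 I2 a0.
by move: #|C| #|_ :\: _| #|_| #|_| #|_|; clear; lia.
Qed.

Definition graft E1 c E2 r := [set r; c] |: (E1 :|: E2).

(** In a tree only one vertex of the branch is adjacent to [r], so [pick] has no freedom. The
    default [r] is a dummy value. *)
Definition attach_point E r C := odflt r [pick x in C | [set r; x] \in E].

Lemma tree_split S E r w : tree_on S E -> r \in S -> w \in S -> w != r ->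
  let C := branch E r w in let c := attach_point E r C in
  [/\ c \in C, tree_on C (induced E C), tree_on (S :\: C) (induced E (S :\: C))
    & graft (induced E C) c (induced E (S :\: C)) r = E].
Proof.
case/and3P=> gE cE /eqP nE rS wS wr C c.
have sCS := branch_sub r gE wS; rewrite -/C in sCS.
have rC : r \notin C := branchN _ wr.
have [cC rcE]: c \in C /\ [set r; c] \in E.
  have [d dC rdE] := branch_attach cE rS wS wr.
  rewrite /c /attach_point; case: pickP => [x /andP[]//|/(_ d)/=].
  by rewrite dC rdE.
have cS : #|S| = #|C| + #|S :\: C| by rewrite -(cardsID C S) (setIidPr sCS).
have C0 : 0 < #|C| by apply/card_gt0P; exists w; exact: branch_root.
have D0 : 0 < #|S :\: C| by apply/card_gt0P; exists r; rewrite inE rC.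
have g1 : graph_on C (induced E C) := graph_on_induced _ gE.
have c1 : connected_on C (induced E C) := branch_connected _ _ _.
have g2 : graph_on (S :\: C) (induced E (S :\: C)) := graph_on_induced _ gE.
have c2 : connected_on (S :\: C) (induced E (S :\: C)) := trunk_connected gE cE rS wr.
have n1 := connected_card g1 c1; have n2 := connected_card g2 c2.
have rcA := mem_attach S wr cC rcE.
have a0 : 0 < #|attach_edges S E r w| by apply/card_gt0P; exists [set r; c].
have nE' := card_branch_edges r w gE; rewrite -/C in nE'.
(* The lower bounds of [connected_card] on the two pieces and the one crossing edge already sum to
   [#|S| - 1]. A tree attains this total, so all three bounds are equalities. *)
have [a1 k1 k2] : [/\ #|attach_edges S E r w| == 1,
    #|induced E C| == #|C|.-1 & #|induced E (S :\: C)| == #|S :\: C|.-1].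
  move: nE; rewrite nE' cS; move: C0 D0 n1 n2 a0.
  move: #|C| #|_ :\: _| #|induced E C| #|_| #|_|.
  by clear; move=> a b x y z *; split; apply/eqP; lia.
split=> //; first by rewrite /tree_on g1 c1.
  by rewrite /tree_on g2 c2.
have{a1} [e A1] := cards1P a1; move: rcA; rewrite A1 inE => /eqP rce.
rewrite /graft rce -A1 /attach_edges -/C; apply/setP=> f.
rewrite !inE; case: (f \in E); rewrite ?andbT ?andbF //=.
by case: (_ \subset _); case: (_ \subset _).
Qed.

(** * Recovering the two pieces from a graft *)

Section Graft.
Variables (S1 S2 : {set V}) (E1 E2 : {set {set V}}) (c r w : V).
Hypotheses (dS : [disjoint S1 & S2]) (g1 : graph_on S1 E1) (g2 : graph_on S2 E2).
Hypotheses (cS1 : c \in S1) (rS2 : r \in S2).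
Let E := graft E1 c E2 r.

Lemma notin_right x : x \in S1 -> x \notin S2.
Proof. by move=> x1; rewrite (disjointFr dS). Qed.

Lemma notin_left x : x \in S2 -> x \notin S1.
Proof. by move=> x2; rewrite (disjointFl dS). Qed.

Lemma graft_edges_disjoint : [disjoint E1 & E2].
Proof.
apply/pred0P=> e /=; apply/negP => /andP[e1 e2].
have [s1 n1] := graph_onP g1 e1; have [s2 _] := graph_onP g2 e2.
have /card_gt0P[x xe]: 0 < #|e| by rewrite n1.
by have := notin_right (subsetP s1 x xe); rewrite (subsetP s2).
Qed.

Lemma graft_edgeN : [set r; c] \notin E1 :|: E2.
Proof.
rewrite inE; apply/norP; split; apply/negP.
  case/(graph_onP g1); rewrite subUset !sub1set => /andP[r1 _] _.
  by have := notin_left rS2; rewrite r1.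
case/(graph_onP g2); rewrite subUset !sub1set => /andP[_ c2] _.
by have := notin_right cS1; rewrite c2.
Qed.

Lemma graft_neq : r != c.
Proof. by apply: contraTneq rS2 => ->; apply: notin_right. Qed.

Lemma induced_graft1 : induced E S1 = E1.
Proof.
apply/setP=> e; rewrite !inE; apply/andP/idP=> [[]|e1]; last first.
  by rewrite e1 orbT; have [] := graph_onP g1 e1.
case/or3P=> // [/eqP->|e2 s1].
  by rewrite subUset sub1set (negPf (notin_left rS2)).
have [s2 n2] := graph_onP g2 e2; have /card_gt0P[x xe]: 0 < #|e| by rewrite n2.
by have := notin_right (subsetP s1 x xe); rewrite (subsetP s2).
Qed.

Lemma induced_graft2 : induced E S2 = E2.
Proof.
apply/setP=> e; rewrite !inE; apply/andP/idP=> [[]|e2]; last first.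
  by rewrite e2 !orbT; have [] := graph_onP g2 e2.
case/or3P=> // [/eqP->|e1 s2].
  by rewrite subUset !sub1set (negPf (notin_right cS1)) andbF.
have [s1 n1] := graph_onP g1 e1; have /card_gt0P[x xe]: 0 < #|e| by rewrite n1.
by have := notin_right (subsetP s1 x xe); rewrite (subsetP s2).
Qed.

(** The only edge between the two sides contains [r]. Once [r] is deleted nothing leaves [S1], while
    all of [E1] survives. *)
Lemma branch_graft : w \in S1 -> connected_on S1 E1 -> branch E r w = S1.
Proof.
move=> w1 c1; apply/setP=> v; rewrite inE; apply/idP/idP.
  apply: (connect_ind (P := fun v => v \in S1)) => // a b aS1.
  rewrite /edge_rel in_set => /andP[+ rab]; rewrite /E /graft in_setU1 in_setU.
  case/or3P=> [/eqP ab||]; first by rewrite ab !inE eqxx in rab.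
    by case/(graph_onP g1)=> /subsetP s1 _; rewrite s1 // !inE eqxx orbT.
  case/(graph_onP g2)=> /subsetP s2 _; have := notin_right aS1.
  by rewrite s2 // !inE eqxx.
move=> v1; apply: connect_edge_relS (connected_onP c1 w1 v1).
apply/subsetP=> e e1; rewrite !inE e1 !orbT /=; have [s1 _] := graph_onP g1 e1.
by apply: contra (notin_left rS2); exact: (subsetP s1).
Qed.

Lemma attach_point_graft : attach_point E r S1 = c.
Proof.
have P x : (x \in S1) && ([set r; x] \in E) = (x == c).
  apply/andP/eqP=> [[x1]|->]; last by rewrite cS1 !inE eqxx.
  rewrite !inE => /or3P[/eqP e||]; last 2 first.
  - by case/(graph_onP g1); rewrite subUset !sub1set (negPf (notin_left rS2)).
  - by case/(graph_onP g2); rewrite subUset !sub1set (negPf (notin_right x1)) andbF.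
  have: x \in [set r; c] by rewrite -e !inE eqxx orbT.
  rewrite !inE => /orP[]/eqP // xr.
  by have := notin_left rS2; rewrite -xr x1.
by rewrite /attach_point; case: pickP => [x|/(_ c)]; rewrite P ?eqxx // => /eqP.
Qed.

Lemma graft_tree : tree_on S1 E1 -> tree_on S2 E2 -> tree_on (S1 :|: S2) E.
Proof.
case/and3P=> _ c1 /eqP n1 /and3P[_ c2 /eqP n2]; apply/and3P; split.
- apply/forall_inP=> e; rewrite !inE => /or3P[/eqP->|e1|e2].
  + by rewrite subUset !sub1set !inE cS1 rS2 orbT cards2 graft_neq.
  + by have [s ->] := graph_onP g1 e1; rewrite (subset_trans s) // subsetUl.
  + by have [s ->] := graph_onP g2 e2; rewrite (subset_trans s) // subsetUr.
- apply: (@connected_on_root _ _ r) => v; rewrite inE => /orP[v1|v2]; last first.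
    apply: connect_edge_relS (connected_onP c2 rS2 v2).
    by rewrite /E /graft setUA subsetUr.
  apply: (@connect_trans _ _ c); first by apply: connect1; rewrite /edge_rel !inE eqxx.
  apply: connect_edge_relS (connected_onP c1 cS1 v1).
  by rewrite /E /graft setUCA subsetUl.
have k1 : 0 < #|S1| by apply/card_gt0P; exists c.
have k2 : 0 < #|S2| by apply/card_gt0P; exists r.
rewrite cardsU1 graft_edgeN !cardsU n1 n2.
rewrite (disjoint_setI0 dS) (disjoint_setI0 graft_edges_disjoint) !cards0.
by move: k1 k2; move: #|S1| #|S2|; clear; lia.
Qed.

End Graft.
End Trees.

(** * Matching polynomials *)

Section Matchings.
Variable V : finType.
Implicit Types (E M : {set {set V}}) (S : {set V}) (r c : V) (e : {set V}).
Local Open Scope ring_scope.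

Definition matching E M := (M \subset E) && trivIset M.

(** The matching generating polynomial, without signs: its degree is the matching number and its
    leading coefficient counts the maximum matchings. *)
Definition mpol E : {poly rat} := \sum_(M | matching E M) 'X^#|M|.

(** A matching of the union is a pair of matchings, recovered by intersecting with [E1] and [E2].
    Any two matchings combine because edges from different sides share no vertex. *)
Lemma mpolU E1 E2 : [disjoint E1 & E2] ->
    {in E1 & E2, forall e1 e2 : {set V}, [disjoint e1 & e2]} ->
  mpol (E1 :|: E2) = mpol E1 * mpol E2.
Proof.
move=> dE dE12; rewrite /mpol big_distrlr pair_big /=.
rewrite (reindex_onto (fun p => p.1 :|: p.2) (fun M => (M :&: E1, M :&: E2))) /=.
  apply: eq_big => [[M1 M2]|[M1 M2]] /=.
    apply/andP/andP=> [[/andP[sM tM] /eqP[d1 d2]]|].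
      split; [rewrite -d1|rewrite -d2]; rewrite /matching subsetIr;
      by apply: trivIsetS tM; apply: subsetIl.
    case=> /andP[s1 t1] /andP[s2 t2]; split; last first.
      apply/eqP; congr (_, _); rewrite setIUl.
        rewrite (setIidPl s1) [M2 :&: E1](disjoint_setI0 _) ?setU0 //.
        by rewrite disjoint_sym (disjointWr s2).
      rewrite (setIidPl s2) [M1 :&: E2](disjoint_setI0 _) ?set0U //.
      by rewrite (disjointWl s1).
    rewrite /matching setUSS //=; apply/trivIsetP=> A B.
    rewrite !inE => /orP[A1|A2] /orP[B1|B2] AB.
    - exact: (trivIsetP t1).
    - by apply: dE12; rewrite ?(subsetP s1) ?(subsetP s2).
    - by rewrite disjoint_sym; apply: dE12; rewrite ?(subsetP s1) ?(subsetP s2).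
    - exact: (trivIsetP t2).
  case/andP=> /andP[sM _] /eqP[def1 def2]; rewrite -exprD cardsU.
  have s1 : M1 \subset E1 by rewrite -def1 subsetIr.
  have s2 : M2 \subset E2 by rewrite -def2 subsetIr.
  by rewrite (disjoint_setI0 (disjointWl s1 (disjointWr s2 dE))) cards0 subn0.
by move=> M /andP[sM _]; rewrite -setIUr; apply/setIidPl.
Qed.

(** Matchings are sorted by whether they contain [e]. Those that do are [e] together with a matching
    of the edges disjoint from [e]. *)
Lemma mpolU1 E e : e \notin E -> e != set0 ->
  mpol (e |: E) = mpol E + 'X * mpol [set f in E | [disjoint e & f]].
Proof.
move=> eE e0; rewrite {1}/mpol (bigID (fun M => e \notin M)) /=; congr (_ + _).
  apply: eq_bigl => M; rewrite /matching.
  apply/andP/andP=> [[/andP[sM ->] eM]|[sM ->]]; split=> //.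
  - apply/subsetP=> f fM; have := subsetP sM f fM.
    by rewrite !inE => /orP[/eqP fe|//]; rewrite -fe fM in eM.
  - by rewrite (subset_trans sM) // subsetUr.
  - by apply: contra eE; exact: (subsetP sM).
rewrite (reindex_onto (fun M => e |: M) (fun M => M :\ e)) /=; last first.
  by move=> M; rewrite negbK => /andP[_]; exact: setD1K.
rewrite mulr_sumr; apply: eq_big => [M|M].
  rewrite negbK setU11 andbT; apply/andP/andP=> [[/andP[sM tM] /eqP def_M]|[sM tM]].
    have eM : e \notin M by rewrite -def_M !inE eqxx.
    split; last by apply: trivIsetS tM; apply: subsetUr.
    apply/subsetP=> f fM; rewrite inE.
    have fe : e != f by apply: contraNneq eM => ->.
    have: f \in e |: E by apply: (subsetP sM); rewrite !inE fM orbT.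
    rewrite !inE eq_sym (negPf fe) /= => ->.
    by apply: (trivIsetP tM); rewrite // !inE ?eqxx ?fM ?orbT.
  have eM : e \notin M.
    by apply: contra eE => /(subsetP sM); rewrite inE => /andP[].
  split; last by rewrite setU1K.
  apply/andP; split.
    apply: setUS; apply: subset_trans sM _.
    by apply/subsetP=> f; rewrite inE => /andP[].
  apply/trivIsetP=> A B; rewrite !inE => /orP[/eqP->|A1] /orP[/eqP->|B1].
  - by rewrite eqxx.
  - by move=> _; have := subsetP sM B B1; rewrite inE => /andP[].
  - by move=> _; have := subsetP sM A A1; rewrite inE disjoint_sym => /andP[].
  - exact: (trivIsetP tM).
case/andP=> _ /eqP def_M; rewrite cardsU1 -{1}def_M !inE eqxx /= add1n.
by rewrite exprS.
Qed.

Lemma coef_mpol E k : (mpol E)`_k = #|[set M | matching E M & #|M| == k]|%:R.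
Proof.
rewrite /mpol coef_sum -sum1_card natr_sum [RHS]big_mkcond [LHS]big_mkcond /=.
apply: eq_bigr => M _; rewrite inE coefXn eq_sym.
by case: matching => //=; case: eqP.
Qed.

Lemma size_matching E M : matching E M -> (#|M| < size (mpol E))%N.
Proof.
move=> mM; rewrite ltnNge; apply/negP => /leq_sizeP/(_ _ (leqnn _)).
rewrite coef_mpol => /eqP; rewrite pnatr_eq0 cards_eq0 => /eqP/setP/(_ M).
by rewrite !inE mM eqxx.
Qed.

Lemma mpol_neq0 E : mpol E != 0.
Proof.
rewrite -size_poly_gt0; apply: leq_ltn_trans (size_matching (M := set0) _) => //.
by rewrite /matching sub0set; apply/trivIsetP=> A B; rewrite inE.
Qed.

(** The coefficients are cardinals. Positivity is what later excludes cancellation between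
    polynomials of equal degree. *)
Lemma lead_mpol_gt0 E : 0 < lead_coef (mpol E).
Proof.
by rewrite lt_neqAle eq_sym lead_coef_eq0 mpol_neq0 lead_coefE coef_mpol ler0n.
Qed.

Lemma size_mpol_matching E : exists2 M, matching E M & size (mpol E) = #|M|.+1.
Proof.
have := lead_mpol_gt0 E; rewrite lead_coefE coef_mpol ltr0n => /card_gt0P[M].
rewrite inE => /andP[mM /eqP cM]; exists M => //.
by rewrite cM prednK // size_poly_gt0 mpol_neq0.
Qed.

Lemma lead_mpol E : lead_coef (mpol E) =
  #|[set M | matching E M & [forall M', matching E M' ==> (#|M'| <= #|M|)%N]]|%:R.
Proof.
rewrite lead_coefE coef_mpol; congr (_%:R); apply: eq_card => M; rewrite !inE.
have [M0 m0 s0] := size_mpol_matching E; rewrite s0 /=.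
case mM: (matching E M) => //=; apply/eqP/forallP=> [-> M'|maxM].
  by apply/implyP=> /size_matching; rewrite s0 ltnS.
apply/eqP; rewrite eqn_leq (implyP (maxM M0)) // andbT.
by have := size_matching mM; rewrite s0.
Qed.

Lemma matching_del_vertex E r M : matching (del_vertex E r) M -> matching E M.
Proof.
case/andP=> sM tM; rewrite /matching tM andbT (subset_trans sM) //.
by apply/subsetP=> e; rewrite inE => /andP[].
Qed.

Lemma size_mpol_del E r : (size (mpol (del_vertex E r)) <= size (mpol E))%N.
Proof.
have [M /matching_del_vertex mM ->] := size_mpol_matching (del_vertex E r).
exact: size_matching.
Qed.

(** At most one edge of a matching contains [r]; dropping it leaves a matching of the graph without
    [r]. Hence deleting a vertex lowers the degree by at most one. *)
Lemma size_mpol_delS E r : (size (mpol E) <= (size (mpol (del_vertex E r))).+1)%N.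
Proof.
have [M /andP[sM tM] ->] := size_mpol_matching E; rewrite ltnS.
pose N := [set e in M | r \notin e].
have mN : matching (del_vertex E r) N.
  rewrite /matching (trivIsetS _ tM) ?andbT; last first.
    by apply/subsetP=> e; rewrite inE => /andP[].
  by apply/subsetP=> e; rewrite !inE => /andP[/(subsetP sM)-> ->].
apply: leq_trans (size_matching mN).
rewrite -(cardsID [set e : {set V} | r \notin e] M) -addn1 leq_add //.
  by apply: subset_leq_card; apply/subsetP=> e; rewrite !inE.
rewrite leqNgt; apply/negP => /card_gt1P[A [B [+ + AB]]].
rewrite !inE !negbK => /andP[rA AM] /andP[rB BM].
have /pred0P/(_ r) /= := trivIsetP tM _ _ AM BM AB.
by rewrite rA rB.
Qed.

(** * Matching polynomials of a graft *)

Section Graft.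
Variables (S1 S2 : {set V}) (E1 E2 : {set {set V}}) (c r : V).
Hypotheses (dS : [disjoint S1 & S2]) (g1 : graph_on S1 E1) (g2 : graph_on S2 E2).
Hypotheses (cS1 : c \in S1) (rS2 : r \in S2).

Let sub_disjoint (F1 F2 : {set {set V}}) : F1 \subset E1 -> F2 \subset E2 ->
  mpol (F1 :|: F2) = mpol F1 * mpol F2.
Proof.
move=> s1 s2; apply: mpolU.
  apply: disjointWl s1 _; apply: disjointWr s2 _.
  exact: graft_edges_disjoint dS g1 g2.
move=> e1 e2 /(subsetP s1)/(graph_onP g1)[s1' _] /(subsetP s2)/(graph_onP g2)[s2' _].
by apply: disjointWl s1' _; apply: disjointWr s2' _.
Qed.

(** Edge recurrence at the joining edge: a matching that uses it has its other edges away from both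
    [r] and [c]. *)
Lemma mpol_graft : mpol (graft E1 c E2 r) =
  mpol E2 * mpol E1 + 'X * (mpol (del_vertex E2 r) * mpol (del_vertex E1 c)).
Proof.
rewrite mpolU1; last 2 first.
- exact: graft_edgeN dS g1 g2 cS1 rS2.
- by apply/set0Pn; exists r; rewrite !inE eqxx.
rewrite sub_disjoint // mulrC [_ * mpol (del_vertex E1 c)]mulrC.
rewrite -(@sub_disjoint (del_vertex E1 c) (del_vertex E2 r)).
- congr (_ + 'X * mpol _); apply/setP=> e; rewrite !inE andb_orl.
  have drc : [disjoint [set r; c] & e] = (r \notin e) && (c \notin e).
    by rewrite disjoints_subset subUset !sub1set !inE.
  rewrite drc; congr (_ || _); apply: andb_id2l => eE.
    have [/subsetP s1 _] := graph_onP g1 eE.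
    by case: (boolP (r \in e)) => // /s1; rewrite (negPf (notin_left dS rS2)).
  have [/subsetP s2 _] := graph_onP g2 eE.
  by case: (boolP (c \in e)) => [/s2|_]; rewrite ?andbT // (negPf (notin_right dS cS1)).
- by apply/subsetP=> e; rewrite inE => /andP[].
- by apply/subsetP=> e; rewrite inE => /andP[].
Qed.

(** The joining edge disappears together with [r], so the grafted tree stays whole as a separate
    component. *)
Lemma mpol_del_graft :
  mpol (del_vertex (graft E1 c E2 r) r) = mpol (del_vertex E2 r) * mpol E1.
Proof.
rewrite mulrC -sub_disjoint //; last by apply/subsetP=> e; rewrite inE => /andP[].
congr mpol; apply/setP=> e; rewrite !inE.
case: eqP => [->|_] /=; last first.
  rewrite andb_orl; congr (_ || _); apply: andb_idr => /(graph_onP g1)[/subsetP s1 _].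
  by apply: contra (notin_left dS rS2); exact: s1.
have := graft_edgeN dS g1 g2 cS1 rS2; rewrite !inE !eqxx /= andbF orbF.
by case: (_ \in E1).
Qed.

End Graft.
End Matchings.

(** * The grafting recurrence *)

Section RootedTrees.
Variable V : finType.
Implicit Types (E : {set {set V}}) (S : {set V}) (r c w : V).
Local Open Scope ring_scope.

Definition rooted_tree S (p : {set {set V}} * V) := tree_on S p.1 && (p.2 \in S).

(* Both sides sum over rooted trees with a marked vertex other than the root: the
   factor [#|S1|] on the right places the mark in the grafted part. *)
Lemma sum_rooted_graft (phi : {set {set V}} -> V -> rat) S :
  (#|S|%:R - 1) * \sum_(p | rooted_tree S p) phi p.1 p.2 =
  \sum_(S1 : {set V} | S1 \subset S) #|S1|%:R *
    \sum_(p1 | rooted_tree S1 p1) \sum_(p2 | rooted_tree (S :\: S1) p2)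
      phi (graft p1.1 p1.2 p2.1 p2.2) p2.2.
Proof.
rewrite mulr_sumr.
transitivity (\sum_(p | rooted_tree S p) \sum_(w in S :\ p.2) phi p.1 p.2).
  apply: eq_bigr => -[E r] /andP[/= _ rS]; rewrite sumr_const -[RHS]mulr_natl.
  by rewrite (cardsD1 r) rS natrD addrAC subrr add0r.
rewrite pair_big_dep /=.
transitivity (\sum_(S1 : {set V} | S1 \subset S) \sum_(w in S1) \sum_(p1 | rooted_tree S1 p1)
    \sum_(p2 | rooted_tree (S :\: S1) p2) phi (graft p1.1 p1.2 p2.1 p2.2) p2.2);
  last by apply: eq_bigr => S1 _; rewrite sumr_const -[LHS]mulr_natl.
transitivity (\sum_(q : ({set V} * V) * (({set {set V}} * V) * ({set {set V}} * V)) |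
    [&& q.1.1 \subset S, q.1.2 \in q.1.1, rooted_tree q.1.1 q.2.1
      & rooted_tree (S :\: q.1.1) q.2.2])
  phi (graft q.2.1.1 q.2.1.2 q.2.2.1 q.2.2.2) q.2.2.2); last first.
  rewrite pair_big_dep /=.
  under [RHS]eq_bigr => s _ do rewrite pair_big_dep /=.
  rewrite pair_big_dep /=; apply: eq_bigl => -[[S1 w] [p1 p2]] /=.
  by rewrite !andbA.
(* [h] grafts and [h'] cuts off the branch containing the mark. [tree_split] gives [h (h' p) = p],
   and the lemmas on grafts identify the arguments with [h' (h q) = q]. *)
pose h (q : ({set V} * V) * (({set {set V}} * V) * ({set {set V}} * V))) :=
  ((graft q.2.1.1 q.2.1.2 q.2.2.1 q.2.2.2, q.2.2.2), q.1.2).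
pose h' (q : ({set {set V}} * V) * V) := let: ((E, r), w) := q in
  let C := branch E r w in
  ((C, w), ((induced E C, attach_point E r C), (induced E (S :\: C), r))).
rewrite (reindex_onto h h') /=; last first.
  move=> [[E r] w] /= /andP[/andP[/= tE rS]]; rewrite !inE => /andP[wr wS].
  by rewrite /h /=; have [_ _ _ ->] := tree_split tE rS wS wr.
apply: eq_bigl => -[[S1 w] [[E1 c] [E2 r]]]; apply/andP/and4P => /=.
  rewrite !inE => -[/andP[/andP[/= tE rS] /andP[wr wS]] /eqP[def1 defE1 defc defE2]].
  have [cC t1 t2 _] := tree_split tE rS wS wr.
  have [gE _] := andP tE.
  rewrite def1 in cC t1 t2 defE1 defc defE2.
  rewrite defE1 in t1; rewrite defc in cC; rewrite defE2 in t2.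
  have sS1 : S1 \subset S by rewrite -def1; apply: branch_sub gE wS.
  split=> //; first by rewrite -def1 branch_root.
    by rewrite /rooted_tree t1 /=.
  rewrite /rooted_tree t2 /= inE rS andbT -def1.
  exact: branchN.
case=> sS1 w1 /andP[/= t1 c1] /andP[/= t2 r2].
have [[g1 k1 _] [g2 k2 _]] := (and3P t1, and3P t2).
have dS : [disjoint S1 & S :\: S1].
  by rewrite disjoint_sym -setI_eq0 setIC setIDA setIC -setIDA setDv setI0.
have defS : S1 :|: (S :\: S1) = S by rewrite -{2}(setID S S1) (setIidPr sS1).
have br := branch_graft c dS g1 g2 r2 w1 k1.
split.
  rewrite /rooted_tree /= -{1}defS (graft_tree dS g1 g2) //=.
  move: r2; rewrite !inE => /andP[r1 ->] /=; rewrite (subsetP sS1) // andbT.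
  by apply: contraNneq r1 => <-.
rewrite /h /h' /= br (induced_graft1 c dS g1 g2) // (induced_graft2 r dS g1 g2) //.
by rewrite (attach_point_graft dS g1 g2) // eqxx.
Qed.

End RootedTrees.

(** * Root states under grafting *)

Section Kernel.
Local Open Scope ring_scope.
Implicit Types (f g : {poly rat}) (i j l : bool * bool).

(* A state [i] is a pair: [i.1] tells whether the root is free, [i.2] selects the
   leading coefficient of [f] (true) or of [g] (false).  [kernel i j l] is the
   coefficient of (state [j] of the root part) * (state [l] of the grafted part)
   in state [i] of the graft: the root stays free iff it was and the grafted root
   is not; [f] becomes [f2 f1 + X g2 g1], whose summands both have top degree
   unless the two roots are both free or both not. *)
Definition kernel i j l : bool :=
  (i.1 == j.1 && ~~ l.1) &&
  (if i.2 then (j.2 == l.2) && (if j.2 then ~~ (j.1 && l.1) else j.1 || l.1)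
   else ~~ j.2 && l.2).

Lemma big_bool_pair (R : zmodType) (F : bool * bool -> R) :
  \sum_j F j = F (true, true) + F (true, false) + F (false, true) + F (false, false).
Proof.
rewrite (eq_bigr (fun p => F (p.1, p.2))) => [|[] //].
by rewrite -(pair_bigA _ (fun x y => F (x, y))) big_bool /= !big_bool /= addrA.
Qed.

Lemma lead_coefD_eq f g : size f = size g -> 0 < lead_coef f -> 0 < lead_coef g ->
  size (f + g) = size f /\ lead_coef (f + g) = lead_coef f + lead_coef g.
Proof.
move=> sfg f0 g0.
have c0 : (f + g)`_(size f).-1 = lead_coef f + lead_coef g.
  by rewrite coefD !lead_coefE -sfg.
suff s : size (f + g) = size f by split; rewrite // lead_coefE s.
apply/eqP; rewrite eqn_leq (leq_trans (size_polyD _ _)) ?geq_max -?sfg ?leqnn //=.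
rewrite leqNgt; apply/negP => lt_s.
have: 0 < (f + g)`_(size f).-1 by rewrite c0 addr_gt0.
by rewrite nth_default ?ltxx // -ltnS prednK // (leq_trans _ lt_s).
Qed.

(** The indicator makes the weight vanish on trees whose root has the other status, so that all four
    statistics are sums over the same set of rooted trees. *)
Definition pweight i f g : rat :=
  (size f == size g == i.1)%:R * lead_coef (if i.2 then f else g).

Lemma pweight_graft i (f1 g1 f2 g2 : {poly rat}) :
    0 < lead_coef f1 -> 0 < lead_coef g1 -> 0 < lead_coef f2 -> 0 < lead_coef g2 ->
    (size g1 <= size f1 <= (size g1).+1)%N -> (size g2 <= size f2 <= (size g2).+1)%N ->
  pweight i (f2 * f1 + 'X * (g2 * g1)) (g2 * f1) =
  \sum_j \sum_l (kernel i j l)%:R * (pweight j f2 g2 * pweight l f1 g1).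
Proof.
move=> f10 g10 f20 g20 s1 s2.
have nz (p : {poly rat}) : 0 < lead_coef p -> p != 0.
  by move=> p0; rewrite -lead_coef_eq0 gt_eqF.
have [nf1 ng1 nf2 ng2] : [/\ f1 != 0, g1 != 0, f2 != 0 & g2 != 0] by split; apply: nz.
have pf1 : (0 < size f1)%N by rewrite size_poly_gt0.
have pg1 : (0 < size g1)%N by rewrite size_poly_gt0.
have pf2 : (0 < size f2)%N by rewrite size_poly_gt0.
have pg2 : (0 < size g2)%N by rewrite size_poly_gt0.
pose a := f2 * f1; pose b := 'X * (g2 * g1).
have sa : size a = (size f2 + size f1).-1 by rewrite size_mul.
have sb : size b = (size g2 + size g1)%N.
  by rewrite /b mulrC size_mulX ?mulf_neq0 // size_mul // prednK // addn_gt0 pg1 orbT.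
have sg : size (g2 * f1) = (size g2 + size f1).-1 by rewrite size_mul.
have la : lead_coef a = lead_coef f2 * lead_coef f1 by rewrite lead_coefM.
have lb : lead_coef b = lead_coef g2 * lead_coef g1.
  by rewrite /b mulrC lead_coefMX lead_coefM.
have lg : lead_coef (g2 * f1) = lead_coef g2 * lead_coef f1 by rewrite lead_coefM.
pose t1 := size f1 == size g1; pose t2 := size f2 == size g2.
(* Degree comparison of [a] and [b]: with both roots free [b] dominates, with neither free [a]
   dominates, and otherwise the degrees tie and the positive leading coefficients add. *)
have [sab lab] : size (a + b) = (if t1 && t2 then size b else size a) /\
    lead_coef (a + b) = (~~ (t2 && t1))%:R * lead_coef a + (t2 || t1)%:R * lead_coef b.
  move: s1 s2 pf1 pf2; rewrite /t1 /t2; case: eqP; case: eqP => e2 e1 s1 s2 pf1 pf2 /=.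
  - have lt : (size a < size b)%N by rewrite sa sb; move: e1 e2 s1 s2 pf1 pf2;
         move: (size f1) (size g1) (size f2) (size g2); clear; lia.
    by rewrite addrC size_polyDl // lead_coefDl // mul0r add0r mul1r.
  - have [|||-> ->] := @lead_coefD_eq a b.
    + by rewrite sa sb; move: e1 e2 s1 s2 pf1 pf2;
         move: (size f1) (size g1) (size f2) (size g2); clear; lia.
    + by rewrite la mulr_gt0.
    + by rewrite lb mulr_gt0.
    + by rewrite !mul1r.
  - have [|||-> ->] := @lead_coefD_eq a b.
    + by rewrite sa sb; move: e1 e2 s1 s2 pf1 pf2;
         move: (size f1) (size g1) (size f2) (size g2); clear; lia.
    + by rewrite la mulr_gt0.
    + by rewrite lb mulr_gt0.
    + by rewrite !mul1r.
  - have lt : (size b < size a)%N by rewrite sa sb; move: e1 e2 s1 s2 pf1 pf2;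
         move: (size f1) (size g1) (size f2) (size g2); clear; lia.
    by rewrite size_polyDl // lead_coefDl // mul0r addr0 mul1r.
have ft : (size (a + b) == size (g2 * f1)) = t2 && ~~ t1.
  rewrite sab sg sa sb /t1 /t2; move: s1 s2 pf1 pf2.
  move: (size f1) (size g1) (size f2) (size g2); clear; move=> x1 y1 x2 y2.
  by case: (x1 =P y1) => e1; case: (x2 =P y2) => e2 *; apply/eqP; rewrite /=; lia.
rewrite -/a -/b /pweight ft -/t1 -/t2 [lead_coef (if i.2 then _ else _)]fun_if lab lg la lb.
rewrite !big_bool_pair.
clear sab lab ft; move: t1 t2 => [] []; case: i => [[] []]; rewrite /kernel /=;
  rewrite ?(mul0r, mul1r, mulr0, add0r, addr0) //.
Qed.
End Kernel.

(** * Rooted counts depend only on the number of vertices *)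

Section RootedCount.
Local Open Scope ring_scope.
Implicit Types (V : finType) (i j l : bool * bool).

Definition weight V i (E : {set {set V}}) (r : V) : rat :=
  pweight i (mpol E) (mpol (del_vertex E r)).

Definition rooted_count V i (S : {set V}) : rat :=
  \sum_(p | rooted_tree S p) weight i p.1 p.2.

Lemma weight_graft V i (S1 S2 : {set V}) (E1 E2 : {set {set V}}) (c r : V) :
    [disjoint S1 & S2] -> graph_on S1 E1 -> graph_on S2 E2 -> c \in S1 -> r \in S2 ->
  weight i (graft E1 c E2 r) r =
  \sum_j \sum_l (kernel i j l)%:R * (weight j E2 r * weight l E1 c).
Proof.
move=> dS g1 g2 c1 r2.
rewrite /weight (mpol_graft dS g1 g2) // (mpol_del_graft dS g1 g2) //.
by rewrite pweight_graft ?lead_mpol_gt0 // size_mpol_del size_mpol_delS.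
Qed.

Lemma rooted_count_rec V i (S : {set V}) :
  (#|S|%:R - 1) * rooted_count i S =
  \sum_(S1 : {set V} | S1 \subset S) #|S1|%:R *
    \sum_j \sum_l (kernel i j l)%:R * (rooted_count j (S :\: S1) * rooted_count l S1).
Proof.
rewrite sum_rooted_graft; apply: eq_bigr => S1 _; congr (_ * _).
transitivity (\sum_(p1 | rooted_tree S1 p1) \sum_(p2 | rooted_tree (S :\: S1) p2)
    \sum_j \sum_l (kernel i j l)%:R * (weight j p2.1 p2.2 * weight l p1.1 p1.2)).
  apply: eq_bigr => p1 /andP[/and3P[g1 _ _] c1].
  apply: eq_bigr => p2 /andP[/and3P[g2 _ _] r2]; apply: weight_graft g1 g2 c1 r2.
  by rewrite disjoint_sym -setI_eq0 setIC setIDA setIC -setIDA setDv setI0.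
under eq_bigr => p1 _ do rewrite exchange_big /=.
rewrite exchange_big; apply: eq_bigr => j _ /=.
under eq_bigr => p1 _ do rewrite exchange_big /=.
rewrite exchange_big; apply: eq_bigr => l _ /=.
rewrite /rooted_count big_distrlr /= exchange_big mulr_sumr /=.
by apply: eq_bigr => p1 _; rewrite mulr_sumr.
Qed.

Lemma rooted_count0 V i (S : {set V}) : #|S| = 0%N -> rooted_count i S = 0.
Proof.
move/eqP; rewrite cards_eq0 => /eqP->; apply: big1 => p.
by rewrite /rooted_tree inE andbF.
Qed.

Lemma mpol0 V : mpol (set0 : {set {set V}}) = 1.
Proof.
rewrite /mpol (big_pred1 set0) ?cards0 // => M; rewrite /matching subset0 /=.
case: eqP => // ->; apply/trivIsetP=> A B; by rewrite inE.
Qed.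

(** On a single vertex both polynomials are 1, so the root is free and both leading coefficients are
    1. *)
Lemma rooted_count1 V i (S : {set V}) : #|S| = 1%N -> rooted_count i S = i.1%:R.
Proof.
move/eqP/cards1P => [v ->]; rewrite /rooted_count (big_pred1 (set0, v)); last first.
  move=> [E r]; rewrite /rooted_tree /tree_on /= cards1 /= inE.
  apply/andP/eqP=> [[/and3P[_ _ /eqP/cards0_eq->] /eqP->]|[-> ->]] //.
  rewrite cards0 !eqxx andbT; split=> //; apply/andP; split.
    by apply/forall_inP=> e; rewrite inE.
  by apply: (@connected_on_root _ _ _ v) => u; rewrite inE => /eqP->.
rewrite /weight /pweight /= (_ : del_vertex set0 v = set0) ?mpol0 ?eqxx.
  by rewrite if_same lead_coef1 mulr1; case: i.1.
by apply/setP=> e; rewrite !inE.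
Qed.

Lemma sum_subset_card V (S : {set V}) (G : nat -> rat) :
  \sum_(S1 : {set V} | S1 \subset S) G #|S1| = \sum_(k < #|S|.+1) 'C(#|S|, k)%:R * G k.
Proof.
rewrite (partition_big (fun S1 : {set V} => inord #|S1| : 'I_#|S|.+1) xpredT) //=.
apply: eq_bigr => k _; rewrite -cards_draws.
have P (S1 : {set V}) : (S1 \subset S) && (inord #|S1| == k) =
    (S1 \in [set B : {set V} | B \subset S & #|B| == k]).
  rewrite inE; apply: andb_id2l => /subset_leq_card sS1.
  by rewrite -val_eqE /= inordK.
rewrite (eq_bigl _ _ P) mulr_natl -sumr_const; apply: eq_bigr => S1.
by rewrite inE => /andP[_ /eqP->].
Qed.

Definition rooted_card i n := rooted_count i [set: 'I_n].

Let rec_at n i := \sum_(k < n.+1) 'C(n, k)%:R *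
  (k%:R * \sum_j \sum_l (kernel i j l)%:R * (rooted_card j (n - k) * rooted_card l k)).

(** The term of the empty [S1] dies by its factor [#|S1|], and that of [S1 = S] because there is no
    rooted tree on the empty set. Only sizes below [n] remain, where the induction hypothesis
    applies. *)
Let rooted_count_rec_card n V i (S : {set V}) : #|S| = n ->
    (forall m, (m < n)%N -> forall V (S : {set V}), #|S| = m ->
       forall i, rooted_count i S = rooted_card i m) ->
  (n%:R - 1) * rooted_count i S = rec_at n i.
Proof.
move=> cS IH; have := sum_subset_card S (fun k => k%:R * \sum_j \sum_l
  (kernel i j l)%:R * (rooted_card j (n - k) * rooted_card l k)).
rewrite /rec_at cS => <-; rewrite -cS rooted_count_rec; apply: eq_bigr => S1 sS1.
have cD : #|S :\: S1| = (n - #|S1|)%N by rewrite cardsD (setIidPr sS1) cS.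
have le1 := subset_leq_card sS1; rewrite cS in le1 *.
case: (posnP #|S1|) => [->|S1_gt0]; first by rewrite !mul0r.
congr (_ * _); apply: eq_bigr => j _; apply: eq_bigr => l _; congr (_ * _).
case: (eqVneq #|S1| n) => [e|ne].
  rewrite e subnn (rooted_count0 _ (S := S :\: S1)) ?cD ?e ?subnn //.
  by rewrite /rooted_card [rooted_count j [set: _] ]rooted_count0 ?mul0r // cardsT card_ord.
have lt1 : (#|S1| < n)%N by rewrite ltn_neqAle ne.
by rewrite (IH _ _ _ _ cD) ?(IH _ lt1) //; move: S1_gt0 lt1; clear; lia.
Qed.

(** No relabelling is constructed: counts on any two sets of size [n] obey the same recurrence.
    Sizes 0 and 1 are computed directly; from 2 on the factor [n - 1] can be cancelled. *)
Lemma rooted_count_card V i (S : {set V}) : rooted_count i S = rooted_card i #|S|.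
Proof.
suff: forall n V (S : {set V}), #|S| = n -> forall i, rooted_count i S = rooted_card i n.
  exact.
elim/ltn_ind=> n IH W T cT k; have cO : #|[set: 'I_n]| = n by rewrite cardsT card_ord.
case: n => [|[|n]] in IH cT cO *.
- by rewrite /rooted_card !rooted_count0.
- by rewrite /rooted_card !rooted_count1.
have n0 : (n.+2%:R - 1 : rat) != 0 by rewrite -[n.+2]add1n natrD addrAC subrr add0r pnatr_eq0.
by apply: (mulfI n0); rewrite (rooted_count_rec_card _ cT IH) (rooted_count_rec_card _ cO IH).
Qed.

Lemma rooted_card_rec n i : (n%:R - 1) * rooted_card i n = \sum_(k < n.+1) 'C(n, k)%:R *
  (k%:R * \sum_j \sum_l (kernel i j l)%:R * (rooted_card j (n - k) * rooted_card l k)).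
Proof.
apply: rooted_count_rec_card; first by rewrite cardsT card_ord.
by move=> m _ V S <- j; apply: rooted_count_card.
Qed.

(** Each tree has [n] possible roots. A root is either free or not, and in both cases the statistic
    of [f] is the number of maximum matchings of the tree. *)
Lemma Nm_rooted n : (n * Nm n)%:R = rooted_card (true, true) n + rooted_card (false, true) n.
Proof.
rewrite natrM; have -> : (Nm n)%:R = \sum_(E | tree_on [set: 'I_n] E) lead_coef (mpol E) :> rat.
  rewrite /Nm -sum1dep_card natr_sum.
  rewrite -(pair_big_dep (@is_tree n) (@is_max_matching n) (fun _ _ => 1)) /=.
  apply: eq_big => [E|E _].
    rewrite /tree_on cardsT card_ord /is_tree; congr [&& _, _ & _].
      by apply: eq_forallb => e; rewrite subsetT.
    apply/forallP/forall_inP=> [H u _|H u]; last first.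
      by apply/forallP=> v; move/forall_inP: (H u (in_setT u)); apply; rewrite inE.
    by apply/forall_inP=> v _; apply: (forallP (H u)).
  rewrite lead_mpol -sum1_card natr_sum; apply: eq_bigl => M.
  by rewrite inE.
rewrite /rooted_card /rooted_count -big_split mulr_sumr /=.
transitivity (\sum_(E | tree_on [set: 'I_n] E) \sum_(r in [set: 'I_n]) lead_coef (mpol E)).
  by apply: eq_bigr => E _; rewrite sumr_const cardsT card_ord mulr_natl.
rewrite pair_big; apply: eq_bigr => p _; rewrite /weight /pweight /=.
by case: (size _ == size _); rewrite ?mul1r ?mul0r ?addr0 ?add0r.
Qed.
End RootedCount.

(** * Formal power series *)

Section Series.
Local Open Scope ring_scope.
Implicit Types (f g h : fps) (n : nat).

Lemma fpsP f g : (forall n, f n = g n) -> f = g.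
Proof. by move=> fg; apply: funext. Qed.

HB.instance Definition _ := gen_eqMixin fps.
HB.instance Definition _ := gen_choiceMixin fps.

Let addA : associative fps_add.
Proof. by move=> f g h; apply: fpsP => n; apply: addrA. Qed.
Let addC : commutative fps_add.
Proof. by move=> f g; apply: fpsP => n; apply: addrC. Qed.
Let add0 : left_id (fun _ => 0) fps_add.
Proof. by move=> f; apply: fpsP => n; apply: add0r. Qed.
Let addN : left_inverse (fun _ => 0) fps_opp fps_add.
Proof. by move=> f; apply: fpsP => n; apply: addNr. Qed.

HB.instance Definition _ := GRing.isZmodule.Build fps addA addC add0 addN.

(** Coefficient [n] of a product only sees coefficients up to [n], so associativity and
    commutativity are inherited from polynomials by truncation. *)
Let trunc f n : {poly rat} := \poly_(i < n.+1) f i.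

Let mul_poly f g (p q : {poly rat}) n : (forall m, (m <= n)%N -> p`_m = f m) ->
  (forall m, (m <= n)%N -> q`_m = g m) -> fps_mul f g n = (p * q)`_n.
Proof.
move=> pf qg; rewrite coefM; apply: eq_bigr => i _.
by rewrite pf ?qg ?leq_subr // -ltnS.
Qed.

Let truncE f n m : (m <= n)%N -> (trunc f n)`_m = f m.
Proof. by move=> le_mn; rewrite coef_poly ltnS le_mn. Qed.

Let mul_trunc f g n m : (m <= n)%N -> fps_mul f g m = (trunc f n * trunc g n)`_m.
Proof. by move=> le_mn; apply: mul_poly => k km; rewrite truncE // (leq_trans km). Qed.

Let mulA : associative fps_mul.
Proof.
move=> f g h; apply: fpsP => n.
rewrite (@mul_poly _ _ (trunc f n) (trunc g n * trunc h n)) => [|m|m].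
- rewrite mulrA; apply/esym/mul_poly => m mn; last exact: truncE.
  by rewrite -mul_trunc.
- exact: truncE.
by move=> mn; rewrite -mul_trunc.
Qed.

Let mulC : commutative fps_mul.
Proof. by move=> f g; apply: fpsP => n; rewrite !(mul_trunc _ _ (leqnn n)) mulrC. Qed.

Let mul1 : left_id (fps_const 1) fps_mul.
Proof.
move=> f; apply: fpsP => n; rewrite /fps_mul big_ord_recl /= subn0 mul1r.
by rewrite big1 ?addr0 // => i _; rewrite mul0r.
Qed.

Let mulD : left_distributive fps_mul fps_add.
Proof.
move=> f g h; apply: fpsP => n; rewrite /fps_mul /fps_add -big_split /=.
by apply: eq_bigr => i _; rewrite mulrDl.
Qed.

Let one_neq0 : fps_const 1 != 0 :> fps.
Proof. by apply/eqP => /(congr1 (fun f => f 0%N)) /eqP; rewrite oner_eq0. Qed.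

HB.instance Definition _ :=
  GRing.Zmodule_isComNzRing.Build fps mulA mulC mul1 mulD one_neq0.

Lemma fpsDE f g n : (f + g) n = f n + g n. Proof. by []. Qed.
Lemma fpsNE f n : (- f) n = - f n. Proof. by []. Qed.
Lemma fpsME f g n : (f * g) n = \sum_(i < n.+1) f i * g (n - i)%N. Proof. by []. Qed.
Lemma fps_powE f k : fps_pow f k = f ^+ k.
Proof. by elim: k => //= k IHk; rewrite exprS -IHk. Qed.

Lemma fps_sumE (I : Type) (s : seq I) (P : pred I) (F : I -> fps) n :
  (\sum_(i <- s | P i) F i) n = \sum_(i <- s | P i) F i n.
Proof. by apply: (big_morph (fun f : fps => f n)). Qed.

Lemma coef0M f g : (f * g) 0%N = f 0%N * g 0%N.
Proof. by rewrite fpsME big_ord_recl big_ord0 addr0. Qed.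

Lemma coef1M f g : (f * g) 1%N = f 0%N * g 1%N + f 1%N * g 0%N.
Proof. by rewrite fpsME !big_ord_recl big_ord0 addr0. Qed.

Lemma coefXM f n : (fps_X * f) n = if n is m.+1 then f m else 0.
Proof.
case: n => [|n]; first by rewrite coef0M mul0r.
rewrite fpsME big_ord_recl mul0r add0r big_ord_recl /= mul1r subSS subn0.
by rewrite big1 ?addr0 // => i _; rewrite mul0r.
Qed.

Definition theta f : fps := fun n => n%:R * f n.

Lemma thetaD f g : theta (f + g) = theta f + theta g.
Proof. by apply: fpsP => n; rewrite /theta !fpsDE mulrDr. Qed.

Lemma thetaN f : theta (- f) = - theta f.
Proof. by apply: fpsP => n; rewrite /theta !fpsNE mulrN. Qed.

Lemma thetaM f g : theta (f * g) = theta f * g + f * theta g.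
Proof.
apply: fpsP => n; rewrite fpsDE /theta !fpsME mulr_sumr -big_split /=.
apply: eq_bigr => i _; rewrite -{1}(subnKC (ltn_ord i : i <= n)%N) natrD.
ring.
Qed.

Lemma theta1 : theta 1 = 0.
Proof. by apply: fpsP => -[|n]; rewrite /theta ?mul0r // mulr0. Qed.

Lemma thetaX : theta fps_X = fps_X.
Proof. by apply: fpsP => -[|[|n]]; rewrite /theta ?mul0r ?mul1r ?mulr0. Qed.

Lemma thetaXn f k : theta (f ^+ k.+1) = k.+1%:R * f ^+ k * theta f.
Proof.
elim: k => [|k IHk]; first by rewrite expr1 expr0 !mul1r.
rewrite exprS thetaM IHk exprS -[k.+2]addn1 natrD; ring.
Qed.

(** If the coefficients below [n] vanish, coefficient [n] of the equation reads [n * f n = c * f n],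
    which forces [f n = 0] as soon as [n > c]. Identities are proved below by applying this to the
    difference of their sides. *)
Lemma theta_eq0 f h c : h 0%N = c%:R -> (forall n, (n <= c)%N -> f n = 0) ->
  theta f = f * h -> f = 0.
Proof.
move=> h0 f0 ode; apply: fpsP; elim/ltn_ind=> n IHn.
case: (leqP n c) => [/f0//|cn].
have /(congr1 (fun f : fps => f n)) := ode.
rewrite fpsME big_ord_recr /= subnn h0 big1 => [|i _]; last by rewrite IHn ?mul0r.
rewrite add0r /theta mulrC => /eqP; rewrite -subr_eq0 -mulrBr mulf_eq0 subr_eq0.
by rewrite eqr_nat gtn_eqF // orbF => /eqP.
Qed.

Lemma coef_expr_gt f k n : f 0%N = 0 -> (n < k)%N -> (f ^+ k) n = 0.
Proof.
move=> f0; elim: k n => // k IHk n; rewrite ltnS exprS fpsME => le_nk.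
apply: big1 => i _; case: (posnP i) => [->|i0]; first by rewrite f0 mul0r.
rewrite IHk ?mulr0 //; have := ltn_ord i; move: le_nk i0; move: (nat_of_ord i).
by clear; lia.
Qed.

(* The powers [f ^+ k] with [k > n] do not reach the coefficient [n], so any larger
   truncation will do. *)
Lemma fps_expE f n m : f 0%N = 0 -> (n < m)%N ->
  fps_exp f n = \sum_(k < m) (f ^+ k) n / k`!%:R.
Proof.
move=> f0 nm; rewrite /fps_exp (eq_bigr (fun k : 'I__ => (f ^+ k) n / k`!%:R)) => [|k _].
  rewrite (big_ord_widen m (fun k => (f ^+ k) n / k`!%:R) nm) big_mkcond /=.
  apply: eq_bigr => k _; case: ifPn => //; rewrite -leqNgt => nk.
  by rewrite coef_expr_gt ?mul0r.
by rewrite fps_powE.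
Qed.

Lemma fps_exp0 f : fps_exp f 0%N = 1.
Proof. by rewrite /fps_exp big_ord_recl big_ord0 addr0 divr1. Qed.

(** Termwise, [theta (f ^+ k.+1) / k.+1! = f ^+ k * theta f / k!], and the index shifts by one. *)
Lemma theta_exp f : f 0%N = 0 -> theta (fps_exp f) = fps_exp f * theta f.
Proof.
move=> f0; apply: fpsP => n.
rewrite /theta (fps_expE f0 (ltnSn n)) big_ord_recl mulrDr.
rewrite [X in X + _](_ : _ = 0); last first.
  case: n => [|n]; first by rewrite mul0r.
  by rewrite /= expr0 (_ : (1 : fps) n.+1 = 0) // mul0r mulr0.
rewrite add0r mulr_sumr fpsME.
transitivity (\sum_(k < n) (f ^+ k * theta f) n / k`!%:R).
  apply: eq_bigr => k _; have := congr1 (fun g : fps => g n) (thetaXn f k).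
  rewrite /theta /= => e; rewrite /bump /= add1n mulrA e -mulrA.
  rewrite mulr_natl (_ : ((f ^+ k * _) *+ _) n = k.+1%:R * (f ^+ k * theta f) n); last first.
    by elim: k.+1 => [|m IHm]; rewrite ?mulr0n ?mul0r // mulrS fpsDE IHm -natr1 mulrDl mul1r addrC.
  rewrite factS natrM; field; rewrite pnatr_eq0 -lt0n fact_gt0 /=.
  by rewrite (_ : 1 + k%:R = k.+1%:R :> rat) ?pnatr_eq0 // -natr1 addrC.
(* The term [i = n] contains the zero constant coefficient of [theta f]. For the others [i < n], so
   truncating the exponential at [n] terms is long enough. *)
rewrite big_ord_recr /= subnn /theta mul0r mulr0 addr0.
under eq_bigr => k _ do rewrite fpsME mulr_suml.
rewrite exchange_big /= big_ord_recr /= subnn.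
rewrite [X in _ + X]big1 ?addr0 => [|k _]; last by rewrite !(mul0r, mulr0).
apply: eq_bigr => i _; rewrite (fps_expE f0 (ltn_ord i)) mulr_suml.
by apply: eq_bigr => k _; rewrite mulrAC.
Qed.

(** Both sides have constant term 1 and solve [theta y = y * theta (f + g)]. *)
Lemma fps_expD f g : f 0%N = 0 -> g 0%N = 0 -> fps_exp (f + g) = fps_exp f * fps_exp g.
Proof.
move=> f0 g0; apply/eqP; rewrite -subr_eq0; apply/eqP.
have fg0 : (f + g) 0%N = 0 by rewrite fpsDE f0 g0 addr0.
apply: (@theta_eq0 _ (theta (f + g)) 0); first by rewrite /theta mul0r.
  by move=> n; rewrite leqn0 => /eqP->; rewrite fpsDE fpsNE coef0M !fps_exp0 mul1r subrr.
rewrite !thetaD thetaN thetaM !theta_exp // thetaD; ring.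
Qed.

End Series.

(** * Generating functions *)

Section GeneratingFunctions.
Local Open Scope ring_scope.
Implicit Types (i j l : bool * bool) (U : fps).

Definition egf i : fps := fun n => rooted_card i n / n`!%:R.

(** This is [rooted_card_rec] divided by [n!]: the binomial becomes a product of series, the factor
    [k] becomes [theta] on the grafted part, and [n - 1] becomes [theta] minus the identity. *)
Lemma theta_egf i : theta (egf i) =
  egf i + \sum_j \sum_l (kernel i j l)%:R * (theta (egf l) * egf j).
Proof.
apply: fpsP => n; have nf0 : n`!%:R != 0 :> rat by rewrite pnatr_eq0 -lt0n fact_gt0.
rewrite fpsDE fps_sumE addrC; apply/eqP; rewrite -subr_eq; apply/eqP.
rewrite /theta -{2}[egf i n]mul1r -mulrBl {1}/egf mulrA rooted_card_rec.
apply: (canLR (mulfK nf0)); rewrite mulr_suml.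
under [RHS]eq_bigr => j _ do rewrite fps_sumE mulr_suml.
transitivity (\sum_(k < n.+1) \sum_j \sum_l (kernel i j l)%:R *
    (k%:R * egf l k * egf j (n - k)%N) * n`!%:R); last first.
  rewrite exchange_big; apply: eq_bigr => j _; rewrite exchange_big.
  apply: eq_bigr => l _ /=; rewrite -mulr_suml -mulr_sumr; congr (_ * _).
  by case: kernel; rewrite ?(mul1r, mul0r) // mul0r.
apply: eq_bigr => k _; rewrite mulrA mulr_sumr; apply: eq_bigr => j _.
rewrite mulr_sumr; apply: eq_bigr => l _.
have kn : (k <= n)%N by rewrite -ltnS.
have kf0 : k`!%:R != 0 :> rat by rewrite pnatr_eq0 -lt0n fact_gt0.
have nkf0 : (n - k)`!%:R != 0 :> rat by rewrite pnatr_eq0 -lt0n fact_gt0.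
by rewrite /egf -(bin_fact kn) !natrM; field; rewrite kf0 nkf0.
Qed.

Lemma egf_coef0 i : egf i 0%N = 0.
Proof. by rewrite /egf /rooted_card rooted_count0 ?mul0r // cardsT card_ord. Qed.

Lemma egf_coef1 i : egf i 1%N = i.1%:R.
Proof. by rewrite /egf /rooted_card rooted_count1 ?divr1 // cardsT card_ord. Qed.

Local Notation A := (egf (true, true)).
Local Notation A0 := (egf (true, false)).
Local Notation B := (egf (false, true)).
Local Notation P := (egf (false, false)).

Lemma theta_free : theta A = A + (theta B * A + theta P * A0).
Proof. by rewrite [LHS]theta_egf !big_bool_pair /kernel /=; ring. Qed.

Lemma theta_free_deleted : theta A0 = A0 + theta B * A0.
Proof. by rewrite [LHS]theta_egf !big_bool_pair /kernel /=; ring. Qed.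

Lemma theta_covered :
  theta B = B + (theta A * B + theta B * B + theta A0 * A0 + theta A0 * P).
Proof. by rewrite [LHS]theta_egf !big_bool_pair /kernel /=; ring. Qed.

Lemma theta_covered_deleted : theta P = P + (theta A * A0 + theta A * P + theta B * P).
Proof. by rewrite [LHS]theta_egf !big_bool_pair /kernel /=; ring. Qed.

Let one_plus_theta_coef0 f : (1 + theta f) 0%N = 1%:R.
Proof. by rewrite fpsDE /theta mul0r addr0. Qed.

Let low_coefs (f : fps) : f 0%N = 0 -> f 1%N = 0 -> forall n, (n <= 1)%N -> f n = 0.
Proof. by move=> f0 f1 [|[|n]]. Qed.

(** Both sides satisfy [theta y = y * (1 + theta B)]. The multiplier has constant term 1, so
    coefficients 0 and 1 must be compared by hand. *)
Lemma A0_exp : A0 = fps_X * fps_exp B.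
Proof.
apply/eqP; rewrite -subr_eq0; apply/eqP.
apply: (theta_eq0 (one_plus_theta_coef0 B)).
  apply: low_coefs; rewrite fpsDE fpsNE coefXM ?egf_coef0 ?subr0 //.
  by rewrite egf_coef1 fps_exp0 subrr.
rewrite !thetaD thetaN thetaM thetaX theta_exp ?egf_coef0 // theta_free_deleted; ring.
Qed.

Lemma A0P_exp : A0 + P = fps_X * fps_exp (A + B).
Proof.
have AB0 : (A + B) 0%N = 0 by rewrite fpsDE !egf_coef0 addr0.
apply/eqP; rewrite -subr_eq0; apply/eqP.
apply: (theta_eq0 (one_plus_theta_coef0 (A + B))).
  apply: low_coefs; rewrite !fpsDE fpsNE coefXM ?egf_coef0 ?subr0 ?addr0 //.
  by rewrite !egf_coef1 fps_exp0 addr0 subrr.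
rewrite !thetaD thetaN thetaM thetaX theta_exp // thetaD.
rewrite theta_free_deleted theta_covered_deleted; ring.
Qed.

(** In the derivative of the difference the terms [theta A0 * (A0 + P)] cancel, leaving the
    difference times [1 + theta (A + B)]. *)
Lemma B_product : B = A0 * (A0 + P).
Proof.
apply/eqP; rewrite -subr_eq0; apply/eqP.
apply: (theta_eq0 (one_plus_theta_coef0 (A + B))).
  apply: low_coefs; rewrite fpsDE fpsNE ?coef0M ?coef1M !fpsDE ?egf_coef0 ?egf_coef1;
  by rewrite /= ?(mul0r, addr0, mulr0, subr0).
rewrite !thetaD thetaN thetaM !thetaD theta_covered_deleted {1}theta_covered.
rewrite theta_free_deleted; ring.
Qed.

(** The terms [A0 * theta P] cancel, leaving the difference times [1 + theta B]. *)
Lemma A_product : A = A0 + A0 * P.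
Proof.
apply/eqP; rewrite -subr_eq0; apply/eqP.
apply: (theta_eq0 (one_plus_theta_coef0 B)).
  apply: low_coefs; rewrite fpsDE fpsNE fpsDE ?coef0M ?coef1M ?egf_coef0 ?egf_coef1;
  by rewrite /= ?(mul0r, addr0, mulr0, subr0, subrr).
rewrite !thetaD thetaN !thetaD thetaM theta_free theta_free_deleted; ring.
Qed.

Let scale_half2 f : fps_scale (- (1 / 2)) f + fps_scale (- (1 / 2)) f = - f.
Proof. by apply: fpsP => n; rewrite fpsDE fpsNE /fps_scale; field. Qed.

Let scale_nat f k : fps_scale k%:R f = k%:R * f.
Proof.
apply: fpsP => n; rewrite /fps_scale; elim: k => [|k IHk]; first by rewrite !mul0r.
by rewrite -addn1 !natrD !mulrDl fpsDE IHk !mul1r.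
Qed.

Lemma U_equationE U : U_equation U <->
  U = fps_X ^+ 2 * fps_exp (- (fps_X ^+ 2 * fps_exp (2%:R * U)) + fps_X * fps_exp U + 3%:R * U).
Proof.
rewrite -!scale_nat -!fps_powE; split=> [E|E n]; last first.
  exact: (congr1 (fun f : fps => f n) E).
by apply: fpsP => n; apply: E.
Qed.

Lemma egf_U_equation : U_equation B.
Proof.
have B0 := egf_coef0 (false, true); have A0' := egf_coef0 (true, true).
apply/U_equationE.
have -> : fps_exp (2%:R * B) = fps_exp B * fps_exp B.
  by rewrite mulr_natl mulr2n fps_expD.
(* With [x e^B = A0], the product formulas [A = A0 + A0 * P] and [B = A0 * A0 + A0 * P] turn the
   exponent into [A + 2 B]. Then [x^2 e^(A+2B)] factors as [A0 * (A0 + P) = B]. *)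
have -> : - (fps_X ^+ 2 * (fps_exp B * fps_exp B)) + fps_X * fps_exp B + 3%:R * B =
    A + B + B.
  rewrite (_ : fps_X ^+ 2 * _ = (fps_X * fps_exp B) * (fps_X * fps_exp B)); last by ring.
  by rewrite -A0_exp A_product {1 2 3}B_product; ring.
rewrite fps_expD //; last by rewrite fpsDE A0' B0 addr0.
rewrite (_ : _ * _ = (fps_X * fps_exp B) * (fps_X * fps_exp (A + B))); last by ring.
by rewrite -A0_exp -A0P_exp {1}B_product.
Qed.

Definition agree n (f g : fps) := forall m, (m < n)%N -> f m = g m.

Lemma agreeD n f f' g g' : agree n f f' -> agree n g g' -> agree n (f + g) (f' + g').
Proof. by move=> ff gg m mn; rewrite !fpsDE ff ?gg. Qed.

Lemma agreeN n f f' : agree n f f' -> agree n (- f) (- f').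
Proof. by move=> ff m mn; rewrite !fpsNE ff. Qed.

Lemma agreeM n f f' g g' : agree n f f' -> agree n g g' -> agree n (f * g) (f' * g').
Proof.
move=> ff gg m mn; rewrite !fpsME; apply: eq_bigr => i _.
by rewrite ff ?gg // (leq_ltn_trans _ mn) ?leq_subr // -ltnS.
Qed.

Lemma agree_expr n f f' k : agree n f f' -> agree n (f ^+ k) (f' ^+ k).
Proof. by move=> ff; elim: k => // k IHk; rewrite !exprS; apply: agreeM. Qed.

Lemma agree_exp n f f' : agree n f f' -> agree n (fps_exp f) (fps_exp f').
Proof.
move=> ff m mn; apply: eq_bigr => k _; rewrite !fps_powE.
by rewrite (agree_expr k ff mn).
Qed.

(** The right-hand side carries a factor [x], so its coefficients up to [n] are determined by those
    of [U] below [n]; agreement therefore propagates one coefficient at a time. *)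
Lemma U_unique U U' : U_equation U -> U_equation U' -> U = U'.
Proof.
move=> /U_equationE eU /U_equationE eU'.
suff H n : agree n U U' by apply: fpsP => n; apply: (H n.+1).
elim: n => // n IHn m; rewrite ltnS => le_mn.
rewrite eU eU' !expr2 -!mulrA !coefXM; case: m le_mn => // m mn; rewrite !mulrA -!expr2.
apply: (agreeM (n := n)) => //; apply: agree_exp.
apply: agreeD; last exact: agreeM.
apply: agreeD; last by apply: agreeM => //; apply: agree_exp.
by apply: agreeN; apply: agreeM => //; apply: agree_exp; apply: agreeM.
Qed.

Lemma Fm_theta n : n%:R * Fm n = A n + B n.
Proof.
case: n => [|n]; first by rewrite mul0r !egf_coef0 addr0.
by rewrite /Fm mulrA -natrM Nm_rooted mulrDl.
Qed.

Lemma Fm_formula_theta : theta (Fm_formula B) = A + B.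
Proof.
set G := Fm_formula B.
have defG : G = fps_scale (- (1 / 2)) ((A0 + B) ^+ 2) + (1 + B * A0) * A0 + B - B ^+ 2.
  by rewrite -!fps_powE {1 2 3}A0_exp.
(* Doubling clears the factor one half, so that [ring] applies. *)
have G2 : G + G = - (A0 + B) ^+ 2 + 2%:R * (A0 * A0 * B + A0 + B - B ^+ 2).
  rewrite -[- _ ^+ _]scale_half2 defG; ring.
(* This form is chosen so that [theta] produces exactly the quadratic terms of [theta_free] and
   [theta_covered]. *)
have {}G2 : G + G = - (A0 * A0) + 2%:R * (A - A * B + B - A0 * P) - B * B.
  rewrite G2 A_product; have := B_product; set b := B; set a := A0; set p := P => e.
  rewrite (_ : a * p = b - a * a); last by rewrite e; ring.
  ring.
have e : theta G + theta G = 2%:R * (A + B).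
  rewrite -thetaD G2 !(thetaD, thetaN, thetaM) theta1.
  have := theta_covered; have := theta_free.
  set a := A; set b := B; set p := P; set c := A0.
  move: (theta a) (theta b) (theta c) (theta p) => ta tb tc tp e1 e2.
  apply/eqP; rewrite -subr_eq0; apply/eqP.
  transitivity (2%:R * (ta - (a + (tb * a + tp * c))) +
    2%:R * (tb - (b + (ta * b + tb * b + tc * c + tc * p)))); first by ring.
  by rewrite -e1 -e2 !subrr !mulr0 addr0.
apply: fpsP => n; have := congr1 (fun f : fps => f n) e.
rewrite mulr_natl mulr2n !fpsDE => e2; apply: (@mulIf _ 2%:R) => //.
by rewrite mulr_natr mulr2n e2 mulr_natr mulr2n.
Qed.

Lemma Fm_formulaE n : Fm n = Fm_formula B n.
Proof.
case: n => [|n]; last first.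
  apply: (@mulfI _ n.+1%:R); first by rewrite pnatr_eq0.
  by rewrite Fm_theta -[RHS]/(theta _ n.+1) Fm_formula_theta.
have B0 := egf_coef0 (false, true).
rewrite /Fm_formula -[fps_add]/(+%R) -[fps_mul]/( *%R) !fpsDE !fps_powE /fps_opp /fps_scale.
rewrite !expr2 !coef0M !fpsDE B0 !coef0M B0 -[fps_X 0%N]/(0 : rat).
by rewrite !(mul0r, mulr0, addr0, oppr0).
Qed.

End GeneratingFunctions.

(** * First values *)

Section Values.
Local Open Scope ring_scope.
Implicit Types (i j l : bool * bool).

Definition states : seq (bool * bool) :=
  [:: (true, true); (true, false); (false, true); (false, false)].

(* [rooted_card i n] for [n = 0 .. 10]. *)
Definition card_table i : seq N := match i with
  | (true, true) => [:: 0; 1; 0; 12; 36; 860; 9870; 195132; 4141592; 98622288; 2801872890]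
  | (true, false) => [:: 0; 1; 0; 6; 24; 360; 5160; 84210; 1915536; 43636824; 1234125360]
  | (false, true) => [:: 0; 0; 2; 6; 60; 740; 9750; 193242; 3855656; 96843672; 2646418410]
  | (false, false) => [:: 0; 0; 2; 3; 76; 605; 11046; 193207; 4086440; 103301361; 2805638410]
  end%num.

Definition table i n : N := nth 0%num (card_table i) n.

Definition sumN (T : Type) (s : seq T) (F : T -> N) : N :=
  foldr (fun x acc => N.add (F x) acc) 0%num s.

Definition table_sum i n : N := sumN (iota 0 n.+1) (fun k =>
  N.mul (N.of_nat 'C(n, k)) (N.mul (N.of_nat k) (sumN states (fun j => sumN states (fun l =>
    if kernel i j l then N.mul (table j (n - k)) (table l k) else 0%num))))).

(** The recurrence is checked in binary arithmetic for [n] from 2 to 10. Since [n - 1] is then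
    nonzero, it certifies the tabulated values by induction. *)
Lemma table_step : all (fun n => all (fun i =>
  N.eqb (N.mul (N.of_nat n.-1) (table i n)) (table_sum i n)) states) (iota 2 9).
Proof. by vm_compute. Qed.

Definition rat_of_N (x : N) : rat := (N.to_nat x)%:R.

Lemma rat_of_ND x y : rat_of_N (N.add x y) = rat_of_N x + rat_of_N y.
Proof. by rewrite /rat_of_N Nnat.N2Nat.inj_add -natrD. Qed.

Lemma rat_of_NM x y : rat_of_N (N.mul x y) = rat_of_N x * rat_of_N y.
Proof. by rewrite /rat_of_N Nnat.N2Nat.inj_mul -natrM. Qed.

Lemma rat_of_N_nat n : rat_of_N (N.of_nat n) = n%:R.
Proof. by rewrite /rat_of_N Nnat.Nat2N.id. Qed.

Lemma rat_of_sumN (T : Type) (s : seq T) F :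
  rat_of_N (sumN s F) = \sum_(x <- s) rat_of_N (F x).
Proof. by elim: s => [|x s IHs]; rewrite ?big_nil // big_cons -IHs -rat_of_ND. Qed.

Lemma sum_states (F : bool * bool -> rat) : \sum_(i <- states) F i = \sum_i F i.
Proof. by rewrite big_bool_pair !big_cons big_nil addr0 !addrA. Qed.

Lemma rooted_card_table n i : (n < 11)%N -> rooted_card i n = rat_of_N (table i n).
Proof.
elim/ltn_ind: n i => n IH i n11; case: (ltnP n 2) => n2.
  case: n n2 {IH n11} => [|[|//]] _.
    by rewrite /rooted_card rooted_count0 ?cardsT ?card_ord //; case: i => [[] []].
  by rewrite /rooted_card rooted_count1 ?cardsT ?card_ord //; case: i => [[] []].
have n0 : (n%:R - 1 : rat) != 0.
  by rewrite subr_eq0 -[1]/(1%:R) eqr_nat gtn_eqF.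
apply: (mulfI n0); rewrite rooted_card_rec.
have nin : n \in iota 2 9 by rewrite mem_iota n2.
have iin : i \in states by case: (i) => [[] []].
have /N.eqb_eq /(congr1 rat_of_N) := allP (allP table_step n nin) i iin.
rewrite rat_of_NM rat_of_N_nat -subn1 natrB ?(ltnW n2) // => ->.
rewrite rat_of_sumN -[iota 0 _]/(index_iota 0 n.+1) big_mkord; apply: eq_bigr => k _.
rewrite !rat_of_NM !rat_of_N_nat; congr (_ * _).
case: (posnP k) => [->|k0]; first by rewrite !mul0r.
congr (_ * _); rewrite rat_of_sumN sum_states; apply: eq_bigr => j _.
rewrite rat_of_sumN sum_states; apply: eq_bigr => l _.
case: (kernel i j l); last by rewrite mul0r.
have kn : (k <= n)%N by rewrite -ltnS.
have nk : (n - k < n)%N by rewrite ltn_subrL k0 (leq_trans _ n2).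
rewrite mul1r rat_of_NM (IH _ nk) ?(ltn_trans nk) //.
move: kn; rewrite leq_eqVlt => /orP[/eqP kn|kn]; last by rewrite IH // (ltn_trans kn).
(* For [k = n] the induction hypothesis says nothing about the grafted factor, but the other factor
   is the count on the empty set, which is 0. *)
have -> : table j (n - k) = 0%num by rewrite kn subnn; case: (j) => [[] []].
by rewrite !mul0r.
Qed.

Lemma Nm_table n m : (0 < n < 11)%N ->
    N.eqb (N.add (table (true, true) n) (table (false, true) n)) (N.mul (N.of_nat n) m) ->
  Nm n = N.to_nat m.
Proof.
case/andP=> n0 n11 /N.eqb_eq /(congr1 rat_of_N).
rewrite rat_of_ND rat_of_NM rat_of_N_nat -!rooted_card_table // -Nm_rooted natrM.
have nz : n%:R != 0 :> rat by rewrite pnatr_eq0 -lt0n.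
by move/(mulfI nz)/eqP; rewrite eqr_nat => /eqP.
Qed.

(** Both conversions follow the same recursion on the reversed digits, so they are compared digit by
    digit without expanding the number in unary. *)
Lemma Nat_of_uintE (d : Decimal.uint) : Nat.of_uint d = N.to_nat (N.of_uint d).
Proof.
rewrite /N.of_uint DecimalNat.Unsigned.of_uint_alt DecimalPos.Unsigned.of_uint_alt.
elim: (Decimal.rev d) => // e IH;
  cbn [DecimalNat.Unsigned.of_lu DecimalPos.Unsigned.of_lu]; rewrite IH;
  by rewrite ?Nnat.N2Nat.inj_add ?Nnat.N2Nat.inj_mul.
Qed.

(* Large [nat] literals are parsed as applications of [Nat.of_num_uint], which must
   not be evaluated in unary. *)
Lemma N_to_nat_literal d m :
  N.of_uint d = m -> N.to_nat m = Nat.of_num_uint (Number.UIntDecimal d).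
Proof. by move<-; rewrite -Nat_of_uintE. Qed.

End Values.

Local Open Scope ring_scope.

Theorem theorem4 :
  (exists U : fps, U 0%N = 0 /\ U_equation U /\ forall n, Fm n = Fm_formula U n) /\
  (forall U : fps, U 0%N = 0 -> U_equation U -> forall n, Fm n = Fm_formula U n) /\
  [:: Nm 1; Nm 2; Nm 3; Nm 4; Nm 5; Nm 6; Nm 7; Nm 8; Nm 9; Nm 10] =
  [:: 1; 1; 6; 24; 320; 3270; 55482; 999656; 21718440; 544829130]%N.
Proof.
split; [|split].
- exists (egf (false, true)).
  by split; [exact: egf_coef0 | split; [exact: egf_U_equation | exact: Fm_formulaE]].
- move=> U U0 eU n; rewrite (U_unique eU egf_U_equation); exact: Fm_formulaE.
have N1 : Nm 1 = 1%N.
  by transitivity (N.to_nat 1%num); [apply: Nm_table; vm_compute | lia].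
have N2 : Nm 2 = 1%N.
  by transitivity (N.to_nat 1%num); [apply: Nm_table; vm_compute | lia].
have N3 : Nm 3 = 6%N.
  by transitivity (N.to_nat 6%num); [apply: Nm_table; vm_compute | lia].
have N4 : Nm 4 = 24%N.
  by transitivity (N.to_nat 24%num); [apply: Nm_table; vm_compute | lia].
have N5 : Nm 5 = 320%N.
  by transitivity (N.to_nat 320%num); [apply: Nm_table; vm_compute | lia].
have N6 : Nm 6 = 3270%N.
  by transitivity (N.to_nat 3270%num); [apply: Nm_table; vm_compute | lia].
have N7 : Nm 7 = 55482%N.
  by transitivity (N.to_nat 55482%num); [apply: Nm_table; vm_compute | apply: N_to_nat_literal].
have N8 : Nm 8 = 999656%N.
  by transitivity (N.to_nat 999656%num); [apply: Nm_table; vm_compute | apply: N_to_nat_literal].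
have N9 : Nm 9 = 21718440%N.
  by transitivity (N.to_nat 21718440%num); [apply: Nm_table; vm_compute | apply: N_to_nat_literal].
have N10 : Nm 10 = 544829130%N.
  by transitivity (N.to_nat 544829130%num); [apply: Nm_table; vm_compute | apply: N_to_nat_literal].
rewrite N1 N2 N3 N4 N5 N6 N7 N8 N9 N10; reflexivity.
Qed.
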